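(* Let $n,m,J\ge 1$ be integers, $\Psi\in C(\mathbb{R}^n,\mathbb{R}^n)$, $h\in C(\mathbb{R}^n,\mathbb{R}^m)$, $m_0\in\mathbb{R}^n$, and let $C_0,\Sigma\in\mathbb{R}^{n\times n}$, $\Gamma\in\mathbb{R}^{m\times m}$ be symmetric positive-definite. Let $\mu_0$ be the prior measure on $v=(v_0,\dots,v_J)$ and, for two data sets $y,y'\in\mathbb{R}^{J\times m}$, let $\mu$ and $\mu'$ be the corresponding posterior smoothing measures (all defined in the context). Let $$\mathsf{v}:=\sum_{j=1}^{J}\bigl(1+|h(v_j)|^2\bigr)$$ and assume that $\mathbb{E}^{\mu_0}\mathsf{v}<\infty$. Then for every $r>0$ there exists $c=c(r)$ such that, for all $y,y'$ with $|y|,|y'|\le r$, $$d_{\rm Hell}(\mu,\mu')\le c\,|y-y'|.$$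
   Context: For a symmetric positive-definite matrix $A$ write $|x|_A=|A^{-1/2}x|$, where $|\cdot|$ is the Euclidean norm. The underlying model is $v_{j+1}=\Psi(v_j)+\xi_j$, $v_0\sim N(m_0,C_0)$, with $\xi_j\sim N(0,\Sigma)$ i.i.d., and data $y_{j+1}=h(v_{j+1})+\eta_{j+1}$, with $\eta_{j+1}\sim N(0,\Gamma)$ i.i.d., $j=0,\dots,J-1$; $v_0$, $\{\xi_j\}$, $\{\eta_j\}$ are mutually independent. For $v=(v_0,\dots,v_J)\in\mathbb{R}^{(J+1)\times n}$ and $y=(y_1,\dots,y_J)\in\mathbb{R}^{J\times m}$ set $$\mathsf{J}(v)=\tfrac12|v_0-m_0|_{C_0}^2+\sum_{j=0}^{J-1}\tfrac12|v_{j+1}-\Psi(v_j)|_\Sigma^2,\qquad \Phi(v;y)=\sum_{j=0}^{J-1}\tfrac12|y_{j+1}-h(v_{j+1})|_\Gamma^2 .$$ The prior $\mu_0$ is the probability measure on $\mathbb{R}^{(J+1)\times n}$ with Lebesgue density proportional to $\exp(-\mathsf{J}(v))$. The posterior $\mu$ (resp. $\mu'$) is the probability measure with density proportional to $\exp(-\mathsf{J}(v)-\Phi(v;y))$ (resp. $\exp(-\mathsf{J}(v)-\Phi(v;y'))$). For measures with Lebesgue densities $\rho,\rho'$, $d_{\rm Hell}(\mu,\mu')=\bigl(\tfrac12\int(\sqrt{\rho}-\sqrt{\rho'})^2\,dv\bigr)^{1/2}$. *)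

(* Defs.v *)
From HB Require Import structures.
From mathcomp Require Import all_boot all_order all_algebra.
From mathcomp Require Import all_classical all_reals all_analysis.
From mathcomp Require Import measurable_realfun measurable_fun_approximation.

Set Implicit Arguments.
Unset Strict Implicit.
Unset Printing Implicit Defensive.

Import Order.TTheory GRing.Theory Num.Theory.
Import numFieldNormedType.Exports.

Local Open Scope classical_set_scope.
Local Open Scope ring_scope.

(* Product sigma-algebra on matrices, the analogue of the library's one on
   tuples. On real matrices it is the Borel sigma-algebra, see
   measurable_mx_borel. *)

Definition measure_mx_display : measure_display -> measure_display.
Proof. exact. Qed.

Section measurable_mx.
Context {d} {T : measurableType d} (m n : nat).

Definition mx_cylinders : set (set 'M[T]_(m, n)) :=
  [set A | exists i j (B : set T),
    measurable B /\ A = (fun M : 'M[T]_(m, n) => M i j) @^-1` B].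

Let mx_set0 : <<s mx_cylinders >> set0.
Proof. exact: sigma_algebra0. Qed.

Let mx_setC A : <<s mx_cylinders >> A -> <<s mx_cylinders >> (~` A).
Proof. exact: sigma_algebraC. Qed.

Let mx_bigcup (F : _^nat) : (forall i, <<s mx_cylinders >> (F i)) ->
  <<s mx_cylinders >> (\bigcup_i (F i)).
Proof. exact: sigma_algebra_bigcup. Qed.

HB.instance Definition _ := @isMeasurable.Build (measure_mx_display d)
  'M[T]_(m, n) <<s mx_cylinders >> mx_set0 mx_setC mx_bigcup.

Lemma measurable_mx_coord i j :
  measurable_fun [set: 'M[T]_(m, n)] (fun M => M i j).
Proof.
move=> _ B mB; rewrite setTI; apply: sub_sigma_algebra.
by exists i, j, B.
Qed.

Lemma measurable_fun_mx d1 (T1 : measurableType d1) (f : T1 -> 'M[T]_(m, n)) :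
  (forall i j, measurable_fun setT (fun x => f x i j)) -> measurable_fun setT f.
Proof.
move=> mf; apply: (@measurability _ _ _ _ _ _ mx_cylinders) => //.
move=> _ [_ [i [j [B [mB ->]]]] <-]; rewrite setTI.
by rewrite -[X in measurable X]setTI; exact: mf.
Qed.

Lemma measurable_fun_mx_coord d1 (T1 : measurableType d1)
    (f : T1 -> 'M[T]_(m, n)) i j :
  measurable_fun setT f -> measurable_fun setT (fun x => f x i j).
Proof.
by move=> mf; apply: (measurableT_comp (measurable_mx_coord i j) mf).
Qed.

End measurable_mx.

Section borel_mx.
Context {R : realType} {m n : nat}.

Lemma open_measurable_mx (U : set 'M[R]_(m, n)) : open U -> measurable U.
Proof.
move=> oU.
pose box (p : 'M[rat]_(m, n) * 'M[rat]_(m, n)) : set 'M[R]_(m, n) :=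
  [set M | forall i j, M i j \in `]ratr (p.1 i j), ratr (p.2 i j)[ ].
pose F p := if `[< box p `<=` U >] then box p else set0.
have -> : U = \bigcup_p F p.
  apply/seteqP; split => [M UM|M [p _]]; last first.
    by rewrite /F; case: ifPn => // /asboolP; apply.
  have /nbhs_ballP[e /= e0 eU] : nbhs M U by exact: open_nbhs_nbhs.
  have /choice[a aP] : forall ij : 'I_m * 'I_n, exists q : rat,
      ratr q \in `]M ij.1 ij.2 - e, M ij.1 ij.2[.
    by move=> ij; apply: rat_in_itvoo; rewrite ltrBlDr ltrDl.
  have /choice[b bP] : forall ij : 'I_m * 'I_n, exists q : rat,
      ratr q \in `]M ij.1 ij.2, M ij.1 ij.2 + e[.
    by move=> ij; apply: rat_in_itvoo; rewrite ltrDl.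
  exists (\matrix_(i, j) a (i, j), \matrix_(i, j) b (i, j)) => //.
  rewrite /F; case: ifPn => [_ i j|/asboolP].
    rewrite !mxE in_itv/=; have := aP (i, j); have := bP (i, j).
    by rewrite !in_itv/= => /andP[-> _] /andP[_ ->].
  case=> N boxN; apply: eU; split => // i j.
  have := boxN i j; rewrite !mxE in_itv/= => /andP[aN Nb].
  have := aP (i, j); have := bP (i, j).
  rewrite !in_itv/= => /andP[_ bMe] /andP[Mea _].
  rewrite /ball/= ltr_norml; apply/andP; split.
    by rewrite ltrBrDr addrC ltrBlDr (lt_trans Nb) // .
  by rewrite ltrBlDr -ltrBlDl (lt_trans _ aN).
apply: countable_bigcupT_measurable; first exact: countableP.
move=> p; rewrite /F; case: ifPn => // _.
have -> : box p = \bigcap_i \bigcap_j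
    (fun M : 'M[R]_(m, n) => M i j) @^-1` `]ratr (p.1 i j), ratr (p.2 i j)[.
  apply/seteqP; split => [M bM i _ j _|M bM i j]; first exact: bM.
  exact: (bM i _ j).
apply: fin_bigcap_measurable => // i _; apply: fin_bigcap_measurable => // j _.
rewrite -[X in measurable X]setTI; exact: measurable_mx_coord.
Qed.

Lemma measurable_mx_borel :
  @measurable _ 'M[R]_(m, n) = <<s (@open 'M[R]_(m, n)) >>.
Proof.
apply/seteqP; split; last first.
  apply: smallest_sub; first exact: sigma_algebra_measurable.
  exact: open_measurable_mx.
apply: smallest_sub; first exact: smallest_sigma_algebra.
move=> _ [i [j [B [mB ->]]]].
pose G := image_set_system setT (fun M : 'M[R]_(m, n) => M i j)
  <<s (@open 'M[R]_(m, n)) >>.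
have sG : sigma_algebra setT G.
  by apply: sigma_algebra_image; exact: smallest_sigma_algebra.
suff : G B by rewrite /G /image_set_system/= setTI.
have {mB} : (@ocitv R).-sigma.-measurable B by exact: mB.
move: B; rewrite RGenOpens.measurableE.
apply: smallest_sub => // _ [a [b ->]].
rewrite /G /image_set_system/= setTI; apply: sub_sigma_algebra.
apply: open_comp; last exact: interval_open.
by move=> M _; exact: coord_continuous.
Qed.

Lemma continuous_measurable_mx (f : 'M[R]_(m, n) -> R) :
  continuous f -> measurable_fun setT f.
Proof.
move=> cf; apply: (measurability _ (RGenOpens.measurableE R)).
move=> _ [_ [a [b ->]] <-]; rewrite setTI.
apply: open_measurable_mx; apply: open_comp; last exact: interval_open.
by move=> M _; exact: cf.
Qed.

End borel_mx.

(* Lebesgue measure on R^n and on R^(m x n), as iterated products: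
   entry by entry for a row, then row by row for a matrix. *)

Section lebesgue_mx.
Context {R : realType}.

Definition cons_rV n (p : measurableTypeR R * 'rV[R]_n) : 'rV[R]_(1 + n) :=
  row_mx (const_mx p.1 : 'rV_1) p.2.

Definition cons_mx m n (p : 'rV[R]_n * 'M[R]_(m, n)) : 'M[R]_(1 + m, n) :=
  col_mx p.1 p.2.

Fixpoint lebesgue_rV n : set 'rV[R]_n -> \bar R :=
  match n with
  | 0 => \d_(0 : 'rV[R]_0)
  | n'.+1 => pushforward (lebesgue_measure \x @lebesgue_rV n')%E (@cons_rV n')
  end.

Fixpoint lebesgue_mx m n : set 'M[R]_(m, n) -> \bar R :=
  match m with
  | 0 => \d_(0 : 'M[R]_(0, n))
  | m'.+1 => pushforward (@lebesgue_rV n \x @lebesgue_mx m' n)%E (@cons_mx m' n)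
  end.

End lebesgue_mx.
Arguments lebesgue_rV {R} n _.
Arguments lebesgue_mx {R} m n _.

Lemma sigma_finite_product d1 d2 (T1 : measurableType d1)
    (T2 : measurableType d2) (R : realType)
    (m1 : {sigma_finite_measure set T1 -> \bar R})
    (m2 : {sigma_finite_measure set T2 -> \bar R}) :
  sigma_finite setT (m1 \x m2)%E.
Proof.
have /sigma_finiteP[F [TF ndF Foo]] := sigma_finiteT m1.
have /sigma_finiteP[G [TG ndG Goo]] := sigma_finiteT m2.
exists (fun n => F n `*` G n).
  rewrite -setXTT TF TG predeqE => -[x y]; split.
    move=> [/= [n _ Fnx] [k _ Gky]]; exists (maxn n k) => //; split.
    - by move: x Fnx; exact/subsetPset/ndF/leq_maxl.
    - by move: y Gky; exact/subsetPset/ndG/leq_maxr.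
  by move=> [n _ []/= ? ?]; split; exists n.
move=> k; have [? ?] := Foo k; have [? ?] := Goo k.
split; first exact: measurableX.
by rewrite product_measure1E// lte_mul_pinfty// ge0_fin_numE.
Qed.

Section sigma_finite_pushforward.
Local Open Scope ereal_scope.
Context d1 d2 (T1 : measurableType d1) (T2 : measurableType d2) (R : realType).
Variables (mu : {measure set T1 -> \bar R}) (sf_mu : sigma_finite setT mu).
Variables (f : T1 -> T2) (g : T2 -> T1).
Hypotheses (mf : measurable_fun setT f) (mg : measurable_fun setT g).
Hypothesis fK : cancel f g.

Let nu : set T2 -> \bar R := pushforward mu f.

Let nu0 : nu set0 = 0. Proof. exact: measure0. Qed.

Let nu_ge0 A : 0 <= nu A. Proof. exact: measure_ge0. Qed.

Let nu_sigma_additive : semi_sigma_additive nu.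
Proof. exact: measure_semi_sigma_additive. Qed.

HB.instance Definition _ := isMeasure.Build _ _ _ nu
  nu0 nu_ge0 nu_sigma_additive.

Let nu_sigma_finite : sigma_finite setT nu.
Proof.
have [F TF mF] := sf_mu.
exists (fun k => g @^-1` F k).
  apply/seteqP; split => // y _; rewrite -preimage_bigcup -TF//.
move=> k; have [mFk Foo] := mF k; split.
  by rewrite -[X in measurable X]setTI; exact: mg.
rewrite /nu /pushforward -comp_preimage (_ : g \o f = id) ?preimage_id//.
by apply/funext => x /=; rewrite fK.
Qed.

HB.instance Definition _ := Measure_isSigmaFinite.Build _ _ _ nu
  nu_sigma_finite.

Lemma sigma_finite_pushforward :
  exists m : {sigma_finite_measure set T2 -> \bar R},
    m = pushforward mu f :> (set T2 -> \bar R).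
Proof. by exists nu. Qed.

End sigma_finite_pushforward.

Section lebesgue_mx_measure.
Context {R : realType}.

Lemma measurable_cons_rV n : measurable_fun setT (@cons_rV R n).
Proof.
apply: measurable_fun_mx => i j.
rewrite /cons_rV; have [j'|j'] := fintype.split_ordP (j : 'I_(1 + n)) => ->.
  rewrite [X in measurable_fun _ X](_ : _ = fst); first exact: measurable_fst.
  by apply/funext => p; rewrite row_mxEl mxE.
rewrite [X in measurable_fun _ X](_ : _ = (fun p : measurableTypeR R * 'rV[R]_n => p.2 i j')).
  by apply: measurable_fun_mx_coord; exact: measurable_snd.
by apply/funext => p; rewrite row_mxEr.
Qed.

Lemma measurable_cons_mx m n : measurable_fun setT (@cons_mx R m n).
Proof.
apply: measurable_fun_mx => i j.
rewrite /cons_mx; have [i'|i'] := fintype.split_ordP (i : 'I_(1 + m)) => ->.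
  rewrite [X in measurable_fun _ X](_ : _ = (fun p : 'rV[R]_n * 'M[R]_(m, n) => p.1 i' j)).
    by apply: measurable_fun_mx_coord; exact: measurable_fst.
  by apply/funext => p; rewrite col_mxEu.
rewrite [X in measurable_fun _ X](_ : _ = (fun p : 'rV[R]_n * 'M[R]_(m, n) => p.2 i' j)).
  by apply: measurable_fun_mx_coord; exact: measurable_snd.
by apply/funext => p; rewrite col_mxEd.
Qed.

Lemma lebesgue_rV_ex n :
  exists mu : {sigma_finite_measure set 'rV[R]_n -> \bar R},
    mu = lebesgue_rV n :> (set 'rV[R]_n -> \bar R).
Proof.
elim: n => [|n [mu IH]]; first by exists (\d_(0 : 'rV[R]_0)).
pose g (v : 'rV[R]_(1 + n)) : measurableTypeR R * 'rV[R]_n :=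
  (lsubmx v 0 0, rsubmx v).
rewrite /= -IH; apply: (@sigma_finite_pushforward _ _ _ _ _
  (lebesgue_measure \x mu)%E _ _ g).
- exact: sigma_finite_product.
- exact: measurable_cons_rV.
- apply/measurable_fun_pair.
    rewrite [X in measurable_fun _ X](_ : _ = (fun v : 'rV[R]_(1 + n) => v 0 (lshift n 0))).
      exact: measurable_mx_coord.
    by apply/funext => v; rewrite mxE.
  apply: measurable_fun_mx => i j.
  rewrite [X in measurable_fun _ X](_ : _ = (fun v : 'rV[R]_(1 + n) => v i (rshift 1 j))).
    exact: measurable_mx_coord.
  by apply/funext => v; rewrite mxE.
- by case=> x v; rewrite /g /cons_rV row_mxKl row_mxKr mxE.
Qed.

Let lebesgue_rV0 n : lebesgue_rV n set0 = 0%E :> \bar R.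
Proof. by have [mu <-] := lebesgue_rV_ex n. Qed.

Let lebesgue_rV_ge0 n A : (0 <= lebesgue_rV n A :> \bar R)%E.
Proof. by have [mu <-] := lebesgue_rV_ex n. Qed.

Let lebesgue_rV_sigma_additive n :
  semi_sigma_additive (lebesgue_rV n : set 'rV[R]_n -> \bar R).
Proof.
by have [mu <-] := lebesgue_rV_ex n; exact: measure_semi_sigma_additive.
Qed.

HB.instance Definition _ n := isMeasure.Build _ _ _ (@lebesgue_rV R n)
  (lebesgue_rV0 n) (@lebesgue_rV_ge0 n) (@lebesgue_rV_sigma_additive n).

Let lebesgue_rV_sigma_finite n : sigma_finite setT (@lebesgue_rV R n).
Proof. by have [mu <-] := lebesgue_rV_ex n; exact: sigma_finiteT. Qed.

HB.instance Definition _ n := Measure_isSigmaFinite.Build _ _ _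
  (@lebesgue_rV R n) (@lebesgue_rV_sigma_finite n).

Lemma lebesgue_mx_ex m n :
  exists mu : {sigma_finite_measure set 'M[R]_(m, n) -> \bar R},
    mu = lebesgue_mx m n :> (set 'M[R]_(m, n) -> \bar R).
Proof.
elim: m => [|m [mu IH]]; first by exists (\d_(0 : 'M[R]_(0, n))).
pose g (v : 'M[R]_(1 + m, n)) := (usubmx v, dsubmx v).
rewrite /= -IH; apply: (@sigma_finite_pushforward _ _ _ _ _
  (lebesgue_rV n \x mu)%E _ _ g).
- exact: sigma_finite_product.
- exact: measurable_cons_mx.
- apply/measurable_fun_pair; apply: measurable_fun_mx => i j.
    rewrite [X in measurable_fun _ X](_ : _ = (fun v : 'M[R]_(1 + m, n) => v (lshift m i) j)).
      exact: measurable_mx_coord.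
    by apply/funext => v; rewrite mxE.
  rewrite [X in measurable_fun _ X](_ : _ = (fun v : 'M[R]_(1 + m, n) => v (rshift 1 i) j)).
    exact: measurable_mx_coord.
  by apply/funext => v; rewrite mxE.
- by case=> x v; rewrite /g /cons_mx col_mxKu col_mxKd.
Qed.

Let lebesgue_mx0 m n : lebesgue_mx m n set0 = 0%E :> \bar R.
Proof. by have [mu <-] := lebesgue_mx_ex m n. Qed.

Let lebesgue_mx_ge0 m n A : (0 <= lebesgue_mx m n A :> \bar R)%E.
Proof. by have [mu <-] := lebesgue_mx_ex m n. Qed.

Let lebesgue_mx_sigma_additive m n :
  semi_sigma_additive (lebesgue_mx m n : set 'M[R]_(m, n) -> \bar R).
Proof.
by have [mu <-] := lebesgue_mx_ex m n; exact: measure_semi_sigma_additive.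
Qed.

HB.instance Definition _ m n := isMeasure.Build _ _ _ (@lebesgue_mx R m n)
  (lebesgue_mx0 m n) (@lebesgue_mx_ge0 m n) (@lebesgue_mx_sigma_additive m n).

Let lebesgue_mx_sigma_finite m n : sigma_finite setT (@lebesgue_mx R m n).
Proof. by have [mu <-] := lebesgue_mx_ex m n; exact: sigma_finiteT. Qed.

HB.instance Definition _ m n := Measure_isSigmaFinite.Build _ _ _
  (@lebesgue_mx R m n) (@lebesgue_mx_sigma_finite m n).

Lemma cons_rV0 n (p : R * 'rV[R]_n) i :
  (cons_rV p : 'rV[R]_n.+1) i ord0 = p.1.
Proof.
transitivity (cons_rV p i (lshift n ord0)).
  by congr (cons_rV p i _); exact: val_inj.
by rewrite /cons_rV row_mxEl mxE.
Qed.

Lemma cons_rV_lift n (p : R * 'rV[R]_n) i j :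
  (cons_rV p : 'rV[R]_n.+1) i (lift ord0 j) = p.2 i j.
Proof.
transitivity (cons_rV p i (rshift 1 j)).
  by congr (cons_rV p i _); exact: val_inj.
by rewrite /cons_rV row_mxEr.
Qed.

Lemma cons_mx0 m n (p : 'rV[R]_n * 'M[R]_(m, n)) j :
  (cons_mx p : 'M[R]_(m.+1, n)) ord0 j = p.1 ord0 j.
Proof.
transitivity (cons_mx p (lshift m ord0) j).
  by congr (cons_mx p _ j); exact: val_inj.
by rewrite /cons_mx col_mxEu.
Qed.

Lemma cons_mx_lift m n (p : 'rV[R]_n * 'M[R]_(m, n)) i j :
  (cons_mx p : 'M[R]_(m.+1, n)) (lift ord0 i) j = p.2 i j.
Proof.
transitivity (cons_mx p (rshift 1 i) j).
  by congr (cons_mx p _ j); exact: val_inj.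
by rewrite /cons_mx col_mxEd.
Qed.

Lemma lebesgue_rV_box n (B : 'I_n -> set R) : (forall j, measurable (B j)) ->
  lebesgue_rV n [set v : 'rV[R]_n | forall j, B j (v ord0 j)] =
  (\prod_(j < n) lebesgue_measure (B j))%E.
Proof.
elim: n => [|n IH] in B *; move=> mB.
  by rewrite big_ord0 /= diracE mem_set// => -[].
have mBox : measurable [set v : 'rV[R]_n | forall j, B (lift ord0 j) (v ord0 j)].
  rewrite (_ : [set _ | _] = \bigcap_j
      (fun v : 'rV[R]_n => v ord0 j) @^-1` B (lift ord0 j)).
    apply: fin_bigcap_measurable => // j _.
    rewrite -[X in measurable X]setTI; exact: measurable_mx_coord.
  by apply/seteqP; split => [v vB j _|v vB j]; [exact: vB|exact: (vB j)].
rewrite big_ord_recl -(IH (fun j => B (lift ord0 j)))//.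
rewrite -(product_measure1E (lebesgue_measure : {measure set (measurableTypeR R) -> \bar R})
  (lebesgue_rV n : {measure set _ -> \bar R}))//; last exact: mB.
rewrite /= /pushforward; congr ((_ \x _)%E _).
apply/seteqP; split => p /=.
  by move=> h; split=> [|j]; [rewrite -(cons_rV0 p ord0)|rewrite -(cons_rV_lift p)].
move=> [Bx Bv] j; have [->|[k ->]] : j = ord0 \/ exists k, j = lift ord0 k.
    by case: (unliftP ord0 j) => [k|] ->; [right; exists k|left].
  by rewrite cons_rV0.
by rewrite cons_rV_lift.
Qed.

Lemma lebesgue_mx_box m n (B : 'I_m -> 'I_n -> set R) :
  (forall i j, measurable (B i j)) ->
  lebesgue_mx m n [set M : 'M[R]_(m, n) | forall i j, B i j (M i j)] =
  (\prod_(i < m) \prod_(j < n) lebesgue_measure (B i j))%E.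
Proof.
elim: m => [|m IH] in B *; move=> mB.
  by rewrite big_ord0 /= diracE mem_set// => -[].
have mBox p (C : 'I_p -> 'I_n -> set R) : (forall i j, measurable (C i j)) ->
    measurable [set M : 'M[R]_(p, n) | forall i j, C i j (M i j)].
  move=> mC; rewrite (_ : [set _ | _] = \bigcap_i \bigcap_j
      (fun M : 'M[R]_(p, n) => M i j) @^-1` C i j).
    apply: fin_bigcap_measurable => // i _; apply: fin_bigcap_measurable => // j _.
    by rewrite -[X in measurable X]setTI; exact: measurable_mx_coord.
  apply/seteqP; split => [M MC i _ j _|M MC i j]; first exact: MC.
  exact: (MC i _ j).
rewrite big_ord_recl -(IH (fun i => B (lift ord0 i)))//.
rewrite -lebesgue_rV_box//.
rewrite -(product_measure1E (lebesgue_rV n : {measure set _ -> \bar R})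
  (lebesgue_mx m n : {measure set _ -> \bar R})); last 2 first.
- rewrite (_ : [set _ | _] =
    [set M : 'rV[R]_n | forall i j, B ord0 j (M i j)]); first exact: (mBox 1%N (fun=> B ord0)).
  apply/seteqP; split => [v h i j|v h j]; last exact: h.
  by rewrite ord1.
- exact: (mBox m (fun i => B (lift ord0 i))).
rewrite /= /pushforward; congr ((_ \x _)%E _).
apply/seteqP; split => p /=.
  by move=> h; split=> [j|i j]; [rewrite -(cons_mx0 p)|rewrite -(cons_mx_lift p)].
move=> [Bx Bv] i j; have [->|[k ->]] : i = ord0 \/ exists k, i = lift ord0 k.
    by case: (unliftP ord0 i) => [k|] ->; [right; exists k|left].
  by rewrite cons_mx0.
by rewrite cons_mx_lift.
Qed.

End lebesgue_mx_measure.

Section gibbs.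
Local Open Scope ereal_scope.
Context d (T : measurableType d) (R : realType).
Variables (mu : {measure set T -> \bar R}) (g : {mfun T >-> R}).

Definition gibbs (A : set T) : \bar R := \int[mu]_(x in A) (expR (- g x))%:E.

Let mexp A : measurable_fun A (fun x => (expR (- g x))%:E).
Proof.
apply/measurable_funTS/measurable_EFinP/measurableT_comp => //.
exact: measurable_funN.
Qed.

Let gibbs0 : gibbs set0 = 0. Proof. exact: integral_set0. Qed.

Let gibbs_ge0 A : 0 <= gibbs A.
Proof. by apply: integral_ge0 => x _; rewrite lee_fin expR_ge0. Qed.

Let gibbs_sigma_additive : semi_sigma_additive gibbs.
Proof.
move=> F mF tF mUF; rewrite /gibbs ge0_integral_bigcup//.
apply: is_cvg_ereal_nneg_natsum_cond => k _ _; exact: gibbs_ge0.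
Qed.

HB.instance Definition _ := isMeasure.Build _ _ _ gibbs
  gibbs0 gibbs_ge0 gibbs_sigma_additive.

End gibbs.

(* The probability measure with mu-density proportional to exp(- g); the Dirac
   measure is only the value of mnormalize when the total mass is 0 or +oo. *)
Definition gibbs_probability d (T : measurableType d) (R : realType)
    (mu : {measure set T -> \bar R}) (g : {mfun T >-> R}) : probability T R :=
  mnormalize (gibbs mu g) (dirac point).

(* The Hellinger distance of two mu-absolutely continuous probability measures. *)
Definition hellinger d (T : measurableType d) (R : realType)
    (mu : {sigma_finite_measure set T -> \bar R}) (P Q : probability T R)
    : \bar R :=
  let rho (P : probability T R) x :=
    fine (Radon_Nikodym (charge_of_finite_measure P) mu x) in
  sqrte (2^-1%:E * \int[mu]_x
    ((Num.sqrt (rho P x) - Num.sqrt (rho Q x)) ^+ 2)%:E)%E.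

Section weighted_norm.
Context {R : realType}.

(* The norm `|M| of the library is the maximum norm. *)
Definition enorm m n (M : 'M[R]_(m, n)) : R :=
  Num.sqrt (\sum_i \sum_j M i j ^+ 2).

Definition spd n (A : 'M[R]_n) : Prop :=
  A^T = A /\ forall x : 'cV[R]_n, x != 0 -> 0 < (x^T *m A *m x) ord0 ord0.

(* The unique symmetric positive-definite square root of an spd A. *)
Definition sqrtmx n (A : 'M[R]_n) : 'M[R]_n :=
  xget 0 [set S | spd S /\ S *m S = A].

(* |x|_A; vectors are rows, hence the transposition. *)
Definition wnorm n (A : 'M[R]_n) (x : 'rV[R]_n) : R :=
  enorm (invmx (sqrtmx A) *m x^T).

Lemma measurable_wnorm d (T : measurableType d) n (A : 'M[R]_n)
    (f : T -> 'rV[R]_n) :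
  measurable_fun setT f -> measurable_fun setT (fun x => wnorm A (f x)).
Proof.
move=> mf; rewrite /wnorm /enorm.
apply: (@measurableT_comp _ _ _ _ _ _ (@Num.sqrt R)).
  apply: continuous_measurable_fun; exact: sqrt_continuous.
apply: measurable_sum => i; apply: measurable_sum => j.
apply: measurable_funX.
under eq_fun do rewrite mxE.
apply: measurable_sum => k; apply: measurable_funM => //.
under eq_fun do rewrite mxE.
exact: measurable_fun_mx_coord.
Qed.

Lemma measurable_row m n i : measurable_fun setT (@row R m n i).
Proof.
apply: measurable_fun_mx => k j; under eq_fun do rewrite mxE.
exact: measurable_mx_coord.
Qed.

Lemma measurable_mxB d (T : measurableType d) m n (f g : T -> 'M[R]_(m, n)) :
  measurable_fun setT f -> measurable_fun setT g ->
  measurable_fun setT (fun x => f x - g x).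
Proof.
move=> mf mg; apply: measurable_fun_mx => i j.
under eq_fun do rewrite !mxE.
by apply: measurable_funB; exact: measurable_fun_mx_coord.
Qed.

Lemma measurable_continuousType m n p q
    (f : continuousType 'M[R]_(m, n) 'M[R]_(p, q)) : measurable_fun setT f.
Proof.
apply: measurable_fun_mx => i j; apply: continuous_measurable_mx => M.
apply: (@continuous_comp _ _ _ f (fun N : 'M[R]_(p, q) => N i j)).
  exact: cts_fun.
exact: coord_continuous.
Qed.

End weighted_norm.

(* A trajectory (v_0, ..., v_J) is the matrix v : 'M_(J.+1, n) with rows
   v_0, ..., v_J; the data (y_1, ..., y_J) is y : 'M_(J, m) with rows
   y_1, ..., y_J, so that y_(j+1) is row j y. *)
Section smoothing.
Context {R : realType} {n m J : nat}.
Variables (Psi : continuousType 'rV[R]_n 'rV[R]_n).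
Variables (h : continuousType 'rV[R]_n 'rV[R]_m).
Variables (m0 : 'rV[R]_n) (C0 Sigma : 'M[R]_n) (Gamma : 'M[R]_m).

Definition state (v : 'M[R]_(J.+1, n)) (j : 'I_J) : 'rV[R]_n :=
  row (widen_ord (leqnSn J) j) v.

Definition next_state (v : 'M[R]_(J.+1, n)) (j : 'I_J) : 'rV[R]_n :=
  row (lift ord0 j) v.

Definition prior_potential (v : 'M[R]_(J.+1, n)) : R :=
  2^-1 * wnorm C0 (row ord0 v - m0) ^+ 2 +
  \sum_(j < J) 2^-1 * wnorm Sigma (next_state v j - Psi (state v j)) ^+ 2.

Definition misfit (y : 'M[R]_(J, m)) (v : 'M[R]_(J.+1, n)) : R :=
  \sum_(j < J) 2^-1 * wnorm Gamma (row j y - h (next_state v j)) ^+ 2.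

Definition posterior_potential (y : 'M[R]_(J, m)) (v : 'M[R]_(J.+1, n)) : R :=
  prior_potential v + misfit y v.

Lemma measurable_prior_potential : measurable_fun setT prior_potential.
Proof.
apply: measurable_funD.
  apply: measurable_funM => //; apply: measurable_funX.
  apply: measurable_wnorm; apply: measurable_mxB => //; exact: measurable_row.
apply: measurable_sum => j; apply: measurable_funM => //.
apply: measurable_funX; apply: measurable_wnorm; apply: measurable_mxB.
  exact: measurable_row.
by apply: measurableT_comp; [exact: measurable_continuousType|
  exact: measurable_row].
Qed.

HB.instance Definition _ := isMeasurableFun.Build _ _ _ _ prior_potential
  measurable_prior_potential.

Lemma measurable_posterior_potential y :
  measurable_fun setT (posterior_potential y).
Proof.
apply: measurable_funD; first exact: measurable_prior_potential.
apply: measurable_sum => j; apply: measurable_funM => //.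
apply: measurable_funX; apply: measurable_wnorm; apply: measurable_mxB => //.
by apply: measurableT_comp; [exact: measurable_continuousType|
  exact: measurable_row].
Qed.

HB.instance Definition _ y := isMeasurableFun.Build _ _ _ _
  (posterior_potential y) (measurable_posterior_potential y).

Definition prior : probability 'M[R]_(J.+1, n) R :=
  gibbs_probability (lebesgue_mx J.+1 n) prior_potential.

Definition posterior (y : 'M[R]_(J, m)) : probability 'M[R]_(J.+1, n) R :=
  gibbs_probability (lebesgue_mx J.+1 n) (posterior_potential y).

End smoothing.

(* Main.v *)
Require Import Defs.
From HB Require Import structures.
From mathcomp Require Import all_boot all_order all_algebra.
From mathcomp Require Import all_classical all_reals all_analysis.
From mathcomp Require Import measurable_realfun.
From mathcomp Require Import complex ring lra.

(* Everything is dominated by V v = \sum_j (1 + |h (v_j)|^2). For data in the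
   ball of radius r the misfit Phi is at most A V, and
     (Phi v y - Phi v y')^2 <= C |y - y'|^2 V v.
   The first bound gives a lower bound Z y >= \int exp(- J - A V) > 0 on the
   normalizing constants that is uniform in y; they are finite because exp(- J)
   is dominated by a Gaussian chain, whose states can be integrated out one
   after the other. Normalizing two functions of L^2 divides their squared
   distance at least by the product of their norms, so that
     2 d_Hell^2 <= (Z y * Z y')^(-1/2) * \int (exp(- g / 2) - exp(- g' / 2))^2,
   where g = J + Phi y and g' = J + Phi y'. As t |-> exp(- t) is 1-Lipschitz on
   the nonnegative reals, the last integral is at most C |y - y'|^2 / 4 times
   \int V exp(- J), which is finite by assumption. *)

Set Implicit Arguments.
Unset Strict Implicit.
Unset Printing Implicit Defensive.

Import Order.TTheory GRing.Theory Num.Theory.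
Import numFieldNormedType.Exports.

Local Open Scope classical_set_scope.
Local Open Scope ring_scope.

(** * Square roots of symmetric positive-definite matrices *)

(** Newton's scheme: [w] vanishes at the earlier nodes but not at [a], so adding a multiple of it
    corrects the value at [a] and keeps the others. *)
Lemma interpolation (F : fieldType) (f : F -> F) (s : seq F) :
  exists p : {poly F}, forall x, x \in s -> p.[x] = f x.
Proof.
elim: s => [|a s [p ps]]; first by exists 0.
have [as_|as_] := boolP (a \in s).
  by exists p => x; rewrite inE => /predU1P[->|]; exact: ps.
pose w := \prod_(x <- s) ('X - x%:P).
have wa : w.[a] != 0 by rewrite -rootE root_prod_XsubC.
exists (p + ((f a - p.[a]) / w.[a])%:P * w) => x.
rewrite inE !hornerE => /predU1P[->|xs]; first by rewrite divfK// addrC subrK.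
rewrite ps// (_ : w.[x] = 0) ?mulr0 ?addr0//.
by apply/eqP; rewrite -rootE root_prod_XsubC.
Qed.

Lemma trmx_horner_mx (R : comNzRingType) n (A : 'M[R]_n.+1) p :
  (horner_mx A p)^T = horner_mx A^T p.
Proof.
elim/poly_ind: p => [|p c IH]; first by rewrite !rmorph0 trmx0.
rewrite !(rmorphD, rmorphM) /= !horner_mx_X !horner_mx_C linearD /= tr_scalar_mx.
rewrite [(_ * _)^T]trmx_mul IH; congr (_ + _).
exact/esym/comm_horner_mx.
Qed.

Section sqrt_spd.
Context {R : realType} {n : nat}.

Lemma spd_eigenvalue_gt0 (A : 'M[R]_n) a : spd A -> eigenvalue A a -> 0 < a.
Proof.
move=> [_ A_gt0] /eigenvalueP[v vA v0].
have : 0 < (v *m A *m v^T) ord0 ord0.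
  by rewrite -[in v *m A](trmxK v); apply: A_gt0; rewrite trmx_eq0.
rewrite vA -scalemxAl mxE.
have : 0 <= (v *m v^T) ord0 ord0.
  by rewrite mxE sumr_ge0// => i _; rewrite mxE -expr2 sqr_ge0.
by rewrite le_eqVlt => /predU1P[<-|/pmulr_lgt0 ->//]; rewrite mulr0 ltxx.
Qed.

Lemma spd_unitmx (A : 'M[R]_n) : spd A -> A \in unitmx.
Proof.
move=> [_ A_gt0]; apply/negPn/negP => /negPf nA.
have /det0P[v v0 vA] : \det A == 0 by rewrite -[_ == _]negbK -unitfE -unitmxE nA.
have := A_gt0 v^T; rewrite trmx_eq0 v0 trmxK vA mul0mx mxE ltxx.
by move=> /(_ isT).
Qed.

End sqrt_spd.

(* Polynomials in A with real coefficients bring the spectral theorem, which the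
   library has over algebraically closed fields only, back to R. *)
Lemma symmetric_annihilator (R : realType) n (A : 'M[R]_n.+1) : A^T = A ->
  exists s : seq R, (forall a, a \in s -> eigenvalue A a) /\
    forall p : {poly R}, (forall a, a \in s -> root p a) -> horner_mx A p = 0.
Proof.
move=> A_sym; pose AC := map_mx (real_complex R) A.
have AC_herm : AC \is hermsymmx.
  apply: realsym_hermsym.
    apply/is_hermitianmxP; rewrite expr0 scale1r; apply/matrixP => i j.
    by rewrite !mxE -[in LHS]A_sym mxE.
  by apply/mxOverP => i j; rewrite mxE; apply/complex_realP; exists (A i j).
have ACE := orthomx_spectralP (hermitian_normalmx AC_herm).
have d_real := hermitian_spectral_diag_real AC_herm.
set P := spectralmx AC in ACE; set d := spectral_diag AC in ACE d_real.
have P_unit : P \in unitmx := spectral_unit AC.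
have dE i : d 0 i = real_complex R (complex.Re (d 0 i)).
  by apply/esym/RRe_real; exact: (mxOverP d_real).
exists [seq complex.Re (d 0 i) | i : 'I_n.+1]; split.
  move=> _ /mapP[i _ ->]; rewrite -(eigenvalue_map (real_complex R)) /= -dE -/AC.
  apply/eigenvalueP; exists (row i P).
    rewrite ACE !mulmxA -row_mul mulmxV// row1 -rowE row_diag_mx.
    by rewrite -scalemxAl -rowE.
  (* A vanishing row of [P] would make the same row of P P^-1 = 1 vanish. *)
  apply/eqP => Pi0; have : row i (P *m invmx P) = 0 by rewrite row_mul Pi0 mul0mx.
  by rewrite mulmxV// => /rowP/(_ i); rewrite !mxE eqxx => /eqP; rewrite oner_eq0.
(* Over the complex numbers p(A) is conjugate to the diagonal matrix of the values of [p] at the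
   eigenvalues, all of which are 0. *)
move=> p p0; apply/eqP; rewrite -(map_mx_eq0 (real_complex R)) map_horner_mx.
rewrite -/AC [X in horner_mx X]ACE horner_mx_uconjC// horner_mx_diag.
suff -> : map_mx (horner (map_poly (real_complex R) p)) d = 0.
  by rewrite linear0 mulmx0 mul0mx.
apply/rowP => i; rewrite !mxE dE horner_map /=.
by rewrite (eqP (p0 _ _)) ?rmorph0//; apply: map_f; rewrite mem_enum.
Qed.

(* The root is T^2 for a symmetric fourth root T of A, which makes it positive:
   x^T T^2 x = |T x|^2. *)
Lemma spd_sqrt_ex (R : realType) n (A : 'M[R]_n) :
  spd A -> exists S, spd S /\ S *m S = A.
Proof.
case: n A => [|n] A spdA.
  by exists A; split=> //; apply/matrixP=> -[].
have [A_sym A_gt0] := spdA.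
have [s [sA s0]] := symmetric_annihilator A_sym.
have [q qE] := interpolation (fun x => Num.sqrt (Num.sqrt x)) s.
pose T := horner_mx A q.
have T_sym : T^T = T by rewrite trmx_horner_mx A_sym.
have T4 : (T *m T) *m (T *m T) = A.
  (* The polynomial q^4 - X vanishes on the spectrum [s], hence annihilates [A]. *)
  transitivity (horner_mx A (q * q * (q * q))); first by rewrite !rmorphM.
  apply/eqP; rewrite -subr_eq0 -[X in _ - X]horner_mx_X -rmorphB.
  apply/eqP/s0 => a as_; rewrite /root !hornerE qE// subr_eq0.
  have a_gt0 : 0 < a by apply: (spd_eigenvalue_gt0 spdA); exact: sA.
  by rewrite /= -mulrA -!expr2 !sqr_sqrtr ?sqrtr_ge0// ltW.
exists (T *m T); split=> //; split=> [|x x0]; first by rewrite trmx_mul T_sym.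
(* T x = 0 would give A x = T^4 x = 0, and [A] is invertible. *)
have Tx0 : T *m x != 0.
  apply: contraNneq x0 => Tx0; apply/eqP.
  rewrite -[LHS](mulKmx (spd_unitmx spdA)) -T4.
  by rewrite -!mulmxA Tx0 !mulmx0.
rewrite mulmxA -mulmxA -[T in x^T *m T]T_sym -trmx_mul mxE lt_neqAle.
rewrite sumr_ge0 ?andbT; last by move=> i _; rewrite mxE -expr2 sqr_ge0.
apply: contra Tx0; rewrite eq_sym psumr_eq0; last first.
  by move=> i _; rewrite mxE -expr2 sqr_ge0.
move=> /allP Tx0; apply/eqP/colP => i.
have := Tx0 i (mem_index_enum _); rewrite mxE -expr2 sqrf_eq0 => /eqP ->.
by rewrite mxE.
Qed.

(** Since a root exists, [xget] does not fall back on its default 0. *)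
Lemma sqrtmxP (R : realType) n (A : 'M[R]_n) : spd A ->
  spd (sqrtmx A) /\ sqrtmx A *m sqrtmx A = A.
Proof.
move=> /spd_sqrt_ex; rewrite /sqrtmx.
exact: (@xgetPex _ 0 [set S | spd S /\ S *m S = A]).
Qed.

(** * Euclidean and weighted norms *)

(** Cauchy-Schwarz by Lagrange's identity: the double sum of (a_i b_j - a_j b_i)^2 is twice the
    difference of the two sides. *)
Lemma sum_mul_sqr_le (R : realDomainType) (I : finType) (a b : I -> R) :
  (\sum_i a i * b i) ^+ 2 <= (\sum_i a i ^+ 2) * (\sum_i b i ^+ 2).
Proof.
have : 0 <= \sum_i \sum_j (a i * b j - a j * b i) ^+ 2.
  by apply: sumr_ge0 => i _; apply: sumr_ge0 => j _; exact: sqr_ge0.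
have sumM (f g : I -> R) : (\sum_i f i) * (\sum_j g j) = \sum_i \sum_j f i * g j.
  by rewrite mulr_suml; apply: eq_bigr => i _; rewrite mulr_sumr.
suff -> : \sum_i \sum_j (a i * b j - a j * b i) ^+ 2 =
    ((\sum_i a i ^+ 2) * (\sum_i b i ^+ 2) - (\sum_i a i * b i) ^+ 2) *+ 2.
  by rewrite pmulrn_lge0// subr_ge0.
rewrite mulr2n {2}[(\sum_i a i ^+ 2) * _]mulrC expr2 !sumM -!sumrB -!big_split /=.
apply: eq_bigr => i _; rewrite -!sumrB -!big_split /=.
by apply: eq_bigr => j _; ring.
Qed.

Lemma sum_sqr_le (R : realDomainType) n (a : 'I_n -> R) :
  (\sum_i a i) ^+ 2 <= n%:R * \sum_i a i ^+ 2.
Proof.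
have := sum_mul_sqr_le (fun=> 1) a.
under eq_bigr do rewrite mul1r.
by rewrite expr1n sumr_const card_ord.
Qed.

Section enorm.
Context {R : realType}.

Lemma enorm_ge0 m n (M : 'M[R]_(m, n)) : 0 <= enorm M.
Proof. exact: sqrtr_ge0. Qed.

Lemma enorm_sqr m n (M : 'M[R]_(m, n)) :
  enorm M ^+ 2 = \sum_i \sum_j M i j ^+ 2.
Proof.
rewrite sqr_sqrtr// sumr_ge0// => i _.
by rewrite sumr_ge0// => j _; rewrite sqr_ge0.
Qed.

Lemma enorm_trmx m n (M : 'M[R]_(m, n)) : enorm M^T = enorm M.
Proof.
congr Num.sqrt; rewrite exchange_big /=.
by apply: eq_bigr => i _; apply: eq_bigr => j _; rewrite mxE.
Qed.

Lemma enorm_sqr_rows m n (M : 'M[R]_(m, n)) :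
  enorm M ^+ 2 = \sum_i enorm (row i M) ^+ 2.
Proof.
rewrite enorm_sqr; apply: eq_bigr => i _; rewrite enorm_sqr big_ord1.
by apply: eq_bigr => j _; rewrite mxE.
Qed.

Lemma enorm_row_le m n (M : 'M[R]_(m, n)) i : enorm (row i M) ^+ 2 <= enorm M ^+ 2.
Proof.
rewrite [leRHS]enorm_sqr_rows (bigD1 i)//= lerDl sumr_ge0// => j _.
exact: sqr_ge0.
Qed.

(** On matrices [enorm] is the Frobenius norm; Cauchy-Schwarz is applied to each entry of the
    product. *)
Lemma enormM_sqr_le m n p (M : 'M[R]_(m, n)) (N : 'M[R]_(n, p)) :
  enorm (M *m N) ^+ 2 <= enorm M ^+ 2 * enorm N ^+ 2.
Proof.
rewrite -(enorm_trmx N) !enorm_sqr mulr_suml; apply: ler_sum => i _.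
rewrite mulr_sumr; apply: ler_sum => j _; rewrite mxE.
apply: le_trans (sum_mul_sqr_le _ _) _; rewrite le_eqVlt.
apply/orP; left; apply/eqP.
by congr (_ * _); apply: eq_bigr => k _; rewrite mxE.
Qed.

Lemma enormD_sqr_le m n (M N : 'M[R]_(m, n)) :
  enorm (M + N) ^+ 2 <= 2 * enorm M ^+ 2 + 2 * enorm N ^+ 2.
Proof.
rewrite !enorm_sqr !mulr_sumr -big_split; apply: ler_sum => i _ /=.
rewrite !mulr_sumr -big_split; apply: ler_sum => j _ /=; rewrite mxE.
by have := sqr_ge0 (M i j - N i j); nra.
Qed.

Lemma enormN m n (M : 'M[R]_(m, n)) : enorm (- M) = enorm M.
Proof.
congr Num.sqrt; apply: eq_bigr => i _; apply: eq_bigr => j _.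
by rewrite mxE sqrrN.
Qed.

Lemma wnorm_sqr_le n (A : 'M[R]_n) (x : 'rV[R]_n) :
  wnorm A x ^+ 2 <= enorm (invmx (sqrtmx A)) ^+ 2 * enorm x ^+ 2.
Proof. by rewrite -(enorm_trmx x); exact: enormM_sqr_le. Qed.

(** With S the root of [A], x^T = S (S^-1 x^T) gives |x|^2 <= |S|^2 |x|_A^2. The added 1 keeps the
    constant positive also when |S| = 0, that is for n = 0. *)
Lemma wnorm_sqr_ge n (A : 'M[R]_n) : spd A ->
  exists2 k : R, 0 < k & forall x : 'rV[R]_n, k * enorm x ^+ 2 <= wnorm A x ^+ 2.
Proof.
move=> /sqrtmxP[/spd_unitmx S_unit _]; set S := sqrtmx A in S_unit *.
exists (1 + enorm S ^+ 2)^-1; first by rewrite invr_gt0 ltr_pwDl// sqr_ge0.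
move=> x; rewrite mulrC ler_pdivrMr ?ltr_pwDl ?sqr_ge0// mulrC.
rewrite -(enorm_trmx x) -[x^T](mulKVmx S_unit).
apply: le_trans (enormM_sqr_le _ _) _.
by rewrite ler_wpM2r ?sqr_ge0// lerDr.
Qed.

(* Polarization followed by Cauchy-Schwarz. *)
Lemma wnorm_sqrB_sqr_le n (A : 'M[R]_n) (x y : 'rV[R]_n) :
  (wnorm A x ^+ 2 - wnorm A y ^+ 2) ^+ 2 <=
  wnorm A (x - y) ^+ 2 * wnorm A (x + y) ^+ 2.
Proof.
rewrite /wnorm !enorm_sqr; set B := invmx _.
under eq_bigr do rewrite big_ord1.
under [X in _ - X]eq_bigr do rewrite big_ord1.
under [X in X * _]eq_bigr do rewrite big_ord1.
under [X in _ * X]eq_bigr do rewrite big_ord1.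
apply: le_trans (sum_mul_sqr_le _ _).
rewrite -sumrB le_eqVlt; apply/orP; left; apply/eqP; congr (_ ^+ 2).
apply: eq_bigr => i _; rewrite !linearB !linearD /=.
by rewrite !mxE; ring.
Qed.

End enorm.

(** * Iterated integrals and Gaussian integrals *)

Section iterated_integrals.
Local Open Scope ereal_scope.
Context {R : realType}.

Lemma integral_lebesgue_rVS n (f : 'rV[R]_n.+1 -> \bar R) :
  measurable_fun setT f -> (forall v, 0 <= f v) ->
  \int[lebesgue_rV n.+1]_v f v =
  \int[lebesgue_measure]_(x in [set: measurableTypeR R])
    \int[lebesgue_rV n]_v f (cons_rV (x, v)).
Proof.
move=> mf f0.
have mcons := @measurable_cons_rV R n.
(* The two measures are the same set function with different measure structures. *)
transitivity (\int[pushforward (lebesgue_measure \x lebesgue_rV n)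
  (@cons_rV R n)]_v f v).
  exact: eq_measure_integral.
rewrite ge0_integral_pushforward// preimage_setT fubini_tonelli1//.
- exact: measurableT_comp mf mcons.
- by move=> x; exact: f0.
Qed.

Lemma integral_lebesgue_mxS m n (f : 'M[R]_(m.+1, n) -> \bar R) :
  measurable_fun setT f -> (forall v, 0 <= f v) ->
  \int[lebesgue_mx m.+1 n]_v f v =
  \int[lebesgue_rV n]_x \int[lebesgue_mx m n]_v f (cons_mx (x, v)).
Proof.
move=> mf f0.
have mcons := @measurable_cons_mx R m n.
transitivity (\int[pushforward (lebesgue_rV n \x lebesgue_mx m n)
  (@cons_mx R m n)]_v f v).
  exact: eq_measure_integral.
rewrite ge0_integral_pushforward// preimage_setT fubini_tonelli1//.
- exact: measurableT_comp mf mcons.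
- by move=> x; exact: f0.
Qed.

End iterated_integrals.

Lemma measurable_enorm_sqr (R : realType) d (T : measurableType d) m n
    (f : T -> 'M[R]_(m, n)) :
  measurable_fun setT f -> measurable_fun setT (fun x => enorm (f x) ^+ 2).
Proof.
move=> mf; under eq_fun do rewrite enorm_sqr.
apply: measurable_sum => i; apply: measurable_sum => j.
by apply: measurable_funX; exact: measurable_fun_mx_coord.
Qed.

Lemma measurable_expRN (R : realType) d (T : measurableType d) (k : R) (f : T -> R) :
  measurable_fun setT f -> measurable_fun setT (fun x => (expR (- (k * f x)))%:E).
Proof.
move=> mf; apply/measurable_EFinP/measurableT_comp => //.
by apply: measurable_funN; exact: measurable_funM.
Qed.

Section gaussian_integral.
Local Open Scope ereal_scope.
Context {R : realType}.
Variables (k : R) (k_gt0 : (0 < k)%R).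

(** The integrand is a multiple of the normal density with mean [a] and variance s^2 = 1 / (2 k),
    whose peak value does not depend on [a]. *)
Lemma integral_gauss : exists2 G : R, (0 <= G)%R & forall a,
  \int[lebesgue_measure]_(x in [set: measurableTypeR R])
    (expR (- (k * (x - a) ^+ 2)))%:E = G%:E.
Proof.
pose s := Num.sqrt (k *+ 2)^-1.
have s0 : s != 0%R by rewrite gt_eqF// sqrtr_gt0 invr_gt0 mulrn_wgt0.
exists (normal_peak s)^-1%R; first by rewrite invr_ge0 normal_peak_ge0.
move=> a; rewrite -[RHS]mule1 -(integral_normal_pdf a s).
rewrite -ge0_integralZl_EFin//; last 3 first.
- by move=> x _; rewrite lee_fin normal_pdf_ge0.
- by apply/measurable_EFinP; exact: measurable_normal_pdf.
- by rewrite invr_ge0 normal_peak_ge0.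
apply: eq_integral => x _; rewrite -EFinM normal_pdfE//.
rewrite mulKf ?gt_eqF ?normal_peak_gt0//.
congr (expR _)%:E; rewrite sqr_sqrtr ?invr_ge0 ?mulrn_wge0 1?ltW//.
by rewrite -mulr_natr; field; rewrite gt_eqF.
Qed.

Lemma enorm_cons_rVB n x (v : 'rV[R]_n) (a : 'rV[R]_n.+1) :
  (enorm ((cons_rV (x, v) : 'rV[R]_n.+1) - a) ^+ 2 =
   (x - a ord0 ord0) ^+ 2 + enorm (v - \row_j a ord0 (lift ord0 j)) ^+ 2)%R.
Proof.
have mxBE p (u w : 'rV[R]_p) j : (u - w)%R ord0 j = (u ord0 j - w ord0 j)%R.
  by rewrite !mxE.
rewrite !enorm_sqr !big_ord1 big_ord_recl mxBE cons_rV0; congr (_ + _)%R.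
by apply: eq_bigr => j _; rewrite !mxBE cons_rV_lift mxE.
Qed.

(** One coordinate is integrated at a time. The same [G] serves all centres [a]; in a chain the
    centre is the image of the previous state. *)
Lemma integral_gauss_rV n : exists2 G : R, (0 <= G)%R & forall a,
  \int[lebesgue_rV n]_x (expR (- (k * enorm (x - a) ^+ 2)))%:E = G%:E.
Proof.
have mexp (p : nat) a : measurable_fun [set: 'rV[R]_p]
    (fun x => (expR (- (k * enorm (x - a) ^+ 2)))%:E).
  by apply/measurable_expRN/measurable_enorm_sqr; exact: measurable_mxB.
elim: n => [|n [G G0 IH]].
  exists 1%R => // a; rewrite (eq_measure_integral (\d_(0%R : 'rV[R]_0)))//.
  rewrite integral_dirac ?diracE ?mem_set ?mul1e //; last exact: mexp.
  rewrite enorm_sqr big_ord1 big_ord0.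
  by rewrite mulr0 oppr0 expR0.
have [G1 G10 intG1] := integral_gauss.
exists (G1 * G)%R; first exact: mulr_ge0.
move=> a; rewrite integral_lebesgue_rVS//.
transitivity (\int[lebesgue_measure]_(x in [set: measurableTypeR R])
    ((expR (- (k * (x - a ord0 ord0) ^+ 2)))%:E * G%:E)).
  apply: eq_integral => x _.
  under eq_integral do rewrite enorm_cons_rVB mulrDr opprD expRD EFinM.
  rewrite ge0_integralZl_EFin ?expR_ge0 ?IH//; last exact: mexp.
rewrite ge0_integralZr//.
- by rewrite intG1.
- apply: (@measurable_expRN _ _ (measurableTypeR R)).
  by apply: measurable_funX; exact: measurable_funB.
Qed.

End gaussian_integral.

(** * The Gaussian chain and the mass of the prior *)

Section gaussian_chain.
Context {R : realType} {n : nat}.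
Variables (k : R) (k_gt0 : 0 < k) (g : continuousType 'rV[R]_n 'rV[R]_n).

(** The prior potential with Euclidean norms and without the factors 1/2. The centre [a] is a
    parameter because removing the first state x turns it into g x. *)
Definition chain_sqr J (a : 'rV[R]_n) (v : 'M[R]_(J.+1, n)) : R :=
  enorm (row ord0 v - a) ^+ 2 +
  \sum_(j < J) enorm (next_state v j - g (state v j)) ^+ 2.

Lemma measurable_chain_sqr J a : measurable_fun setT (@chain_sqr J a).
Proof.
apply: measurable_funD.
  apply: measurable_enorm_sqr; apply: measurable_mxB => //.
  exact: measurable_row.
apply: measurable_sum => j; apply: measurable_enorm_sqr.
apply: measurable_mxB; first exact: measurable_row.
by apply: measurableT_comp; [exact: measurable_continuousType|
  exact: measurable_row].
Qed.

Lemma row0_cons_mx m x (v : 'M[R]_(m, n)) :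
  row ord0 (cons_mx (x, v) : 'M[R]_(m.+1, n)) = x.
Proof. by apply/rowP => j; rewrite mxE cons_mx0. Qed.

Lemma row_lift_cons_mx m x (v : 'M[R]_(m, n)) i :
  row (lift ord0 i) (cons_mx (x, v) : 'M[R]_(m.+1, n)) = row i v.
Proof. by apply/rowP => j; rewrite mxE cons_mx_lift mxE. Qed.

Lemma chain_sqr_cons J a x (v : 'M[R]_(J.+1, n)) :
  chain_sqr a (cons_mx (x, v) : 'M[R]_(J.+2, n)) =
  enorm (x - a) ^+ 2 + chain_sqr (g x) v.
Proof.
rewrite /chain_sqr row0_cons_mx; congr (_ + _).
rewrite big_ord_recl /next_state /state row_lift_cons_mx.
rewrite (_ : widen_ord _ ord0 = ord0); last exact: val_inj.
rewrite row0_cons_mx; congr (_ + _); apply: eq_bigr => j _.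
rewrite row_lift_cons_mx.
rewrite (_ : widen_ord _ _ = lift ord0 (widen_ord (leqnSn J) j)).
  by rewrite row_lift_cons_mx.
exact: val_inj.
Qed.

(* The integral of the chain does not depend on its starting point, so the
   last state can be integrated out first. *)
Lemma integral_chain_sqr J : exists G : R, forall a,
  (\int[lebesgue_mx J.+1 n]_v (expR (- (k * chain_sqr a v)))%:E = G%:E)%E.
Proof.
have [G1 G10 intG1] := integral_gauss_rV k_gt0 n.
have mexp p a : measurable_fun [set: 'M[R]_(p.+1, n)]
    (fun v => (expR (- (k * chain_sqr a v)))%:E).
  exact: (measurable_expRN k (@measurable_chain_sqr p a)).
elim: J => [|J [G IH]].
  exists G1 => a; rewrite integral_lebesgue_mxS// -(intG1 a).
  apply: eq_integral => x _.
  rewrite (eq_measure_integral (\d_(0 : 'M[R]_(0, n))))//.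
  rewrite integral_dirac// ?diracE ?mem_set ?mul1e//.
    by rewrite /chain_sqr row0_cons_mx big_ord0 addr0.
  have mcons : measurable_fun setT (fun v : 'M[R]_(0, n) => cons_mx (x, v)).
    apply: measurableT_comp; first exact: measurable_cons_mx.
    exact: pair1_measurable.
    exact: (measurableT_comp (mexp 0%N a) mcons).
exists (G1 * G) => a; rewrite integral_lebesgue_mxS//.
transitivity (\int[lebesgue_rV n]_x
    ((expR (- (k * enorm (x - a) ^+ 2)))%:E * G%:E))%E.
  (* The integral over the later states is [G] whatever their centre g x, so only the Gaussian
     factor of the first state depends on x. *)
  apply: eq_integral => x _.
  under eq_integral do rewrite chain_sqr_cons mulrDr opprD expRD EFinM.
  rewrite ge0_integralZl_EFin ?expR_ge0 ?IH//; first exact: mexp.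
have G0 : 0 <= G.
  by rewrite -lee_fin -(IH a) integral_ge0// => v _; rewrite lee_fin expR_ge0.
rewrite ge0_integralZr// ?intG1//.
by apply: measurable_expRN; apply: measurable_enorm_sqr; exact: measurable_mxB.
Qed.

End gaussian_chain.

Lemma prior_mass_lty (R : realType) (n J : nat)
    (Psi : continuousType 'rV[R]_n 'rV[R]_n) (m0 : 'rV[R]_n) (C0 Sigma : 'M[R]_n) :
  spd C0 -> spd Sigma ->
  (\int[lebesgue_mx J.+1 n]_v
     (expR (- prior_potential Psi m0 C0 Sigma v))%:E < +oo)%E.
Proof.
move=> /wnorm_sqr_ge[k1 k1_gt0 k1P] /wnorm_sqr_ge[k2 k2_gt0 k2P].
(* The factor 1/2 is that of the potential; the minimum serves both covariances. *)
pose k := 2^-1 * Num.min k1 k2.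
have k_gt0 : 0 < k by rewrite mulr_gt0 ?invr_gt0// lt_min k1_gt0.
have [G GP] := integral_chain_sqr k_gt0 Psi J.
apply: (@le_lt_trans _ _ G%:E); last exact: ltry.
rewrite -(GP m0); apply: ge0_le_integral => //.
- apply/measurable_EFinP/measurableT_comp => //.
  by apply: measurable_funN; exact: measurable_prior_potential.
- exact: (measurable_expRN k (@measurable_chain_sqr _ _ Psi J m0)).
move=> v _; rewrite lee_fin ler_expR lerN2 mulrDr mulr_sumr lerD//.
  rewrite -mulrA ler_wpM2l// (le_trans _ (k1P _))// ler_wpM2r ?sqr_ge0//.
  by rewrite ge_min lexx.
apply: ler_sum => j _.
rewrite -mulrA ler_wpM2l// (le_trans _ (k2P _))// ler_wpM2r ?sqr_ge0//.
by rewrite ge_min lexx orbT.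
Qed.

(** This keeps the normalizing constants away from 0. The whole space is a box all of whose sides
    have measure +oo; an empty product is 1. *)
Lemma lebesgue_mx_setT_gt0 (R : realType) m n :
  (0 < lebesgue_mx m n [set: 'M[R]_(m, n)] :> \bar R)%E.
Proof.
rewrite (_ : setT = [set M : 'M[R]_(m, n) | forall i j, setT (M i j)]); last first.
  by apply/seteqP; split.
rewrite (@lebesgue_mx_box R m n (fun _ _ => setT))//.
(* Naming the predicate lets [big_ind] apply to each of the nested products. *)
pose pos (x : \bar R) : Prop := (0 < x)%E.
rewrite -/(pos _); apply: big_ind => [|x y|i _]; rewrite /pos ?lte01//.
  exact: mule_gt0.
rewrite -/(pos _); apply: big_ind => [|x y|j _]; rewrite /pos ?lte01//.
  exact: mule_gt0.
by rewrite -set_itvNyy lebesgue_measure_itv/= addye.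
Qed.

(** * Gibbs measures: densities and Hellinger distance *)

Section gibbs_density.
Local Open Scope ereal_scope.
Context d (T : measurableType d) (R : realType).
Variables (mu : {sigma_finite_measure set T -> \bar R}) (g : {mfun T >-> R}).
Variable Z : R.
Hypotheses (Z_gt0 : (0 < Z)%R) (intZ : \int[mu]_x (expR (- g x))%:E = Z%:E).
Local Notation P := (gibbs_probability mu g).
Local Notation rho := (fun x => (expR (- g x) / Z)%:E).

Lemma measurable_gibbs_density : measurable_fun setT rho.
Proof.
apply/measurable_EFinP/measurable_funM => //; apply: measurableT_comp => //.
exact: measurable_funN.
Qed.

Lemma gibbs_probabilityE A : measurable A -> P A = \int[mu]_(x in A) rho x.
Proof.
move=> mA.
(* The mass [Z] is neither 0 nor +oo, which excludes the Dirac branch of [mnormalize]. *)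
rewrite /gibbs_probability /= /mnormalize /= /gibbs intZ /= eqe gt_eqF//=.
under [RHS]eq_integral do rewrite EFinM.
rewrite ge0_integralZr// ?lee_fin ?invr_ge0 1?ltW//.
apply/measurable_funTS/measurable_EFinP/measurableT_comp => //.
exact: measurable_funN.
Qed.

Lemma gibbs_probability_dominates : P `<< mu.
Proof.
apply/null_content_dominatesP => A mA muA; rewrite gibbs_probabilityE//.
apply: null_set_integral; [exact: mA| |exact: muA].
exact: (measurable_funTS measurable_gibbs_density).
Qed.

(** Both functions have the same integral over every measurable set. [hellinger] is defined through
    the first and gets estimated through the second. *)
Lemma Radon_Nikodym_gibbs :
  ae_eq mu setT (Radon_Nikodym (charge_of_finite_measure P) mu) rho.
Proof.
have Pmu := gibbs_probability_dominates.
apply: integral_ae_eq => //.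
- exact: Radon_Nikodym_integrable.
- exact: measurable_gibbs_density.
- by move=> A _ mA; rewrite -Radon_Nikodym_integral// -gibbs_probabilityE.
Qed.

(** Serves to turn the moment assumption under the prior into a finite integral against Lebesgue
    measure. *)
Lemma integral_gibbs_probability_lty (f : T -> \bar R) :
  measurable_fun setT f -> (forall x, 0 <= f x) ->
  \int[P]_x f x < +oo -> \int[mu]_x (f x * rho x) < +oo.
Proof.
move=> mf f0 intf; have Pmu := gibbs_probability_dominates.
have intPf : P.-integrable setT f.
  by apply/integrableP; split => //; under eq_integral do rewrite gee0_abs//.
rewrite -(Radon_Nikodym_change_of_variables Pmu measurableT)// in intf.
apply: le_lt_trans intf; rewrite le_eqVlt; apply/orP; left; apply/eqP.
have mrho := measurable_gibbs_density.
apply: ae_eq_integral => //.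
- exact: (emeasurable_funM mf mrho).
- exact: emeasurable_funM.
- apply: ae_eqe_mul2l; exact/ae_eq_sym/Radon_Nikodym_gibbs.
Qed.

End gibbs_density.

(** For a <= b the difference is exp(- a) (1 - exp(- (b - a))), where exp(- a) <= 1 and 1 - exp(- t)
    <= t. *)
Lemma expRN_lipschitz (R : realType) (a b : R) : 0 <= a -> 0 <= b ->
  (expR (- a) - expR (- b)) ^+ 2 <= (a - b) ^+ 2.
Proof.
wlog ab : a b / a <= b => [wlog a0 b0|a0 b0].
  have [/wlog|/ltW/wlog] := leP a b; first exact.
  by rewrite -(sqrrN (expR _ - _)) -(sqrrN (a - b)) !opprB; exact.
rewrite -(sqrrN (a - b)) opprB ler_sqr ?nnegrE ?subr_ge0 ?ler_expR ?lerN2//.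
have -> : expR (- b) = expR (- a) * expR (- (b - a)).
  by rewrite -expRD; congr expR; lra.
rewrite -[leLHS](_ : expR (- a) * (1 - expR (- (b - a))) = _); last by ring.
have := expR_ge1Dx (- (b - a)); have : expR (- a) <= 1.
  by rewrite expR_le1 oppr_le0.
have := expR_gt0 (- a); nra.
Qed.

(* For unit vectors u, w of L^2: |u - w|^2 = 2 - 2 <u, w>; dividing f and f' by
   their norms a and b thus brings |f - f'|^2 down at least by a factor a b. *)
Lemma hellinger_gibbs_le d (T : measurableType d) (R : realType)
    (mu : {sigma_finite_measure set T -> \bar R}) (g g' : {mfun T >-> R})
    (Z Z' : R) : 0 < Z -> 0 < Z' ->
  (\int[mu]_x (expR (- g x))%:E = Z%:E)%E ->
  (\int[mu]_x (expR (- g' x))%:E = Z'%:E)%E ->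
  (hellinger mu (gibbs_probability mu g) (gibbs_probability mu g') <=
   sqrte ((2^-1 / (Num.sqrt Z * Num.sqrt Z'))%:E *
     \int[mu]_x ((expR (- (g x / 2)) - expR (- (g' x / 2))) ^+ 2)%:E))%E.
Proof.
move=> Z0 Z'0 intZ intZ'.
pose f x := expR (- (g x / 2)); pose f' x := expR (- (g' x / 2)).
have fE x : expR (- g x) = f x ^+ 2.
  by rewrite expr2 -expRD; congr expR; lra.
have f'E x : expR (- g' x) = f' x ^+ 2.
  by rewrite expr2 -expRD; congr expR; lra.
have mf : measurable_fun setT f.
  apply: measurableT_comp => //; apply: measurable_funN; exact: measurable_funM.
have mf' : measurable_fun setT f'.
  apply: measurableT_comp => //; apply: measurable_funN; exact: measurable_funM.
pose a := Num.sqrt Z; pose b := Num.sqrt Z'.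
have a0 : 0 < a by rewrite sqrtr_gt0.
have b0 : 0 < b by rewrite sqrtr_gt0.
have aE : a ^+ 2 = Z by rewrite sqr_sqrtr// ltW.
have bE : b ^+ 2 = Z' by rewrite sqr_sqrtr// ltW.
have mrho (h : {mfun T >-> R}) W : 0 < W ->
    (\int[mu]_x (expR (- h x))%:E = W%:E)%E ->
    measurable_fun setT (fun x => Num.sqrt (fine
      (Radon_Nikodym (charge_of_finite_measure (gibbs_probability mu h)) mu x))).
  move=> W0 intW; have hmu := gibbs_probability_dominates W0 intW.
  apply: measurableT_comp; last first.
    by apply: measurableT_comp => //; exact: fine_measurable.
  by apply: continuous_measurable_fun; exact: sqrt_continuous.
have sqrtE x y : 0 <= x -> 0 < y -> Num.sqrt (x ^+ 2 / y) = x / Num.sqrt y :> R.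
  by move=> x0 y0; rewrite sqrtrM ?sqr_ge0// sqrtr_sqr ger0_norm// sqrtrV// ltW.
have mI : measurable_fun setT (fun x => ((f x / a - f' x / b) ^+ 2)%:E).
  apply/measurable_EFinP/measurable_funX.
  by apply: measurable_funB; exact: measurable_funM.
rewrite /hellinger /=; set I := (\int[mu]_x _)%E.
(* Almost everywhere the square roots of the two densities are f / a and f' / b. *)
have -> : I = (\int[mu]_x ((f x / a - f' x / b) ^+ 2)%:E)%E.
  apply: ae_eq_integral => //.
    apply/measurable_EFinP/measurable_funX; apply: measurable_funB.
      exact: (mrho _ _ Z0 intZ).
    exact: (mrho _ _ Z'0 intZ').
  apply: filterS2 (Radon_Nikodym_gibbs Z0 intZ) (Radon_Nikodym_gibbs Z'0 intZ').
  by move=> x RNx RN'x _; rewrite RNx// RN'x//= fE f'E !sqrtE ?expR_ge0.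
set H := (\int[mu]_x _)%E; set K := (\int[mu]_x _)%E.
have mK : measurable_fun setT (fun x => ((f x - f' x) ^+ 2)%:E).
  by apply/measurable_EFinP/measurable_funX; exact: measurable_funB.
have mf2 : measurable_fun setT (fun x => (f x ^+ 2)%:E).
  by apply/measurable_EFinP/measurable_funX.
have mf'2 : measurable_fun setT (fun x => (f' x ^+ 2)%:E).
  by apply/measurable_EFinP/measurable_funX.
have K0 : (0 <= K)%E by apply: integral_ge0 => x _; rewrite lee_fin sqr_ge0.
have intf : (\int[mu]_x (f x ^+ 2)%:E = (a ^+ 2)%:E)%E.
  by rewrite aE -intZ; apply: eq_integral => x _; rewrite fE.
have intf' : (\int[mu]_x (f' x ^+ 2)%:E = (b ^+ 2)%:E)%E.
  by rewrite bE -intZ'; apply: eq_integral => x _; rewrite f'E.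
have lin (h : T -> R) (c1 c2 c3 : R) : 0 <= c1 -> 0 <= c2 -> 0 <= c3 ->
    measurable_fun setT (fun x => (h x ^+ 2)%:E) ->
    (\int[mu]_x (c1 * h x ^+ 2 + (c2 * f x ^+ 2 + c3 * f' x ^+ 2))%:E =
     c1%:E * (\int[mu]_x (h x ^+ 2)%:E) + (c2 * a ^+ 2 + c3 * b ^+ 2)%:E)%E.
  move=> c10 c20 c30 mh; under eq_integral do rewrite !EFinD !EFinM.
  have mZ c (u : T -> R) : measurable_fun setT (fun x => (u x ^+ 2)%:E) ->
      measurable_fun setT (fun x => (c%:E * (u x ^+ 2)%:E)%E).
    by move=> mu2; exact: emeasurable_funM.
  have Z_ge0 c (u : T -> R) x : 0 <= c -> (0 <= c%:E * (u x ^+ 2)%:E)%E.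
    by move=> c0; rewrite -EFinM lee_fin mulr_ge0// sqr_ge0.
  rewrite ge0_integralD; [|exact: measurableT|by move=> x _; exact: Z_ge0|
    exact: mZ|by move=> x _; rewrite adde_ge0// Z_ge0|
    by apply: emeasurable_funD; exact: mZ].
  rewrite ge0_integralD; [|exact: measurableT|by move=> x _; exact: Z_ge0|
    exact: mZ|by move=> x _; exact: Z_ge0|exact: mZ].
  rewrite !ge0_integralZl_EFin//; try by move=> x _; rewrite lee_fin sqr_ge0.
  by rewrite intf intf' -!EFinM -EFinD.
have ab0 : 0 < a * b by rewrite mulr_gt0.
(* Both integrands have the cross term - 2 f f' / (a b). The remaining squares are distributed so
   that every term is non-negative and the integrals split without any integrability of the
   differences. *)
have HK : (1%:E * H + ((a * b)^-1 * a ^+ 2 + (a * b)^-1 * b ^+ 2)%:E =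
    (a * b)^-1%:E * K + ((a ^+ 2)^-1 * a ^+ 2 + (b ^+ 2)^-1 * b ^+ 2)%:E)%E.
  rewrite -(lin (fun x => f x / a - f' x / b)) ?invr_ge0 ?ltW//.
  rewrite -(lin (fun x => f x - f' x)) ?invr_ge0 ?sqr_ge0 ?ltW//.
  apply: eq_integral => x _; congr EFin; field.
  by rewrite !gt_eqF.
rewrite lee_sqrt; last by rewrite mule_ge0// lee_fin divr_ge0// ltW.
rewrite EFinM -muleA lee_wpmul2l ?lee_fin ?invr_ge0//.
rewrite mul1e !mulVf ?expf_neq0 ?gt_eqF// in HK.
(* As a / b + b / a >= 2, cancelling the finite constant 2 leaves H <= K / (a b). *)
have two_le : 2 <= (a * b)^-1 * a ^+ 2 + (a * b)^-1 * b ^+ 2.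
  rewrite -mulrDr mulrC ler_pdivlMr//; have := sqr_ge0 (a - b); nra.
rewrite -(@leeD2rE _ (1 + 1)%:E)// -HK leeD2l// lee_fin.
Qed.

(** If the integral were 0, the exponential would vanish almost everywhere; as it vanishes nowhere,
    the whole space would be null. *)
Lemma integral_expRN_gt0 d (T : measurableType d) (R : realType)
    (mu : {measure set T -> \bar R}) (g : T -> R) :
  measurable_fun setT g -> (0 < mu setT)%E ->
  (0 < \int[mu]_x (expR (- g x))%:E)%E.
Proof.
move=> mg muT; rewrite lt0e integral_ge0 ?andbT; last first.
  by move=> x _; rewrite lee_fin expR_ge0.
have me : measurable_fun setT (fun x => (expR (- g x))%:E).
  by apply/measurable_EFinP/measurableT_comp => //; exact: measurable_funN.
apply/eqP => int0.
have /(ae_eq_integral_abs mu measurableT me) :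
    (\int[mu]_x `|(expR (- g x))%:E| = 0)%E.
  rewrite -[RHS]int0; apply: eq_integral => x _.
  by rewrite gee0_abs// lee_fin expR_ge0.
case=> N [mN muN0 subN].
have NT : N = setT.
  apply/seteqP; split => // x _; apply: subN => /= /(_ I) /eqP.
  by rewrite eqe gt_eqF// expR_gt0.
by move: muT; rewrite -NT muN0 ltxx.
Qed.

(** * Bounds on the misfit *)

Section misfit_bounds.
Context {R : realType} {n m J : nat}.
Variables (h : continuousType 'rV[R]_n 'rV[R]_m) (Gamma : 'M[R]_m).
Let K : R := enorm (invmx (sqrtmx Gamma)) ^+ 2.
Let V (v : 'M[R]_(J.+1, n)) : R :=
  \sum_(j < J) (1 + enorm (h (next_state v j)) ^+ 2).

Lemma misfit_ge0 y (v : 'M[R]_(J.+1, n)) : 0 <= misfit h Gamma y v.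
Proof. by apply: sumr_ge0 => j _; rewrite mulr_ge0 ?sqr_ge0. Qed.

Lemma enorm_sqr_row_le r (y : 'M[R]_(J, m)) j : enorm y <= r ->
  enorm (row j y) ^+ 2 <= r ^+ 2.
Proof.
move=> yr; apply: le_trans (enorm_row_le y j) _.
by rewrite ler_sqr ?nnegrE ?enorm_ge0// (le_trans (enorm_ge0 y)).
Qed.

(** The bound 2 r^2 + 2 |x|^2 is weakened to a product that separates the radius from the summand of
    [V]. *)
Lemma enorm_residual_le r (y : 'M[R]_(J, m)) (x : 'rV[R]_m) j : enorm y <= r ->
  enorm (row j y - x) ^+ 2 <= 2 * (r ^+ 2 + 1) * (1 + enorm x ^+ 2).
Proof.
move=> /(enorm_sqr_row_le j) yr; apply: le_trans (enormD_sqr_le _ _) _.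
rewrite enormN; have := sqr_ge0 (enorm x); have := sqr_ge0 r; nra.
Qed.

Lemma misfit_le r y (v : 'M[R]_(J.+1, n)) : enorm y <= r ->
  misfit h Gamma y v <= K * (r ^+ 2 + 1) * V v.
Proof.
move=> yr; rewrite mulr_sumr; apply: ler_sum => j _.
have := wnorm_sqr_le Gamma (row j y - h (next_state v j)).
have := ler_wpM2l (sqr_ge0 (enorm (invmx (sqrtmx Gamma))))
  (enorm_residual_le (h (next_state v j)) j yr).
rewrite -/K; lra.
Qed.

(** Each difference of squared norms factors into a part controlled by y - y' and a part growing
    linearly in |h|, so its square is linear in [V]. The constant 2 K^2 is (1/2)^2 times K times 8
    K. *)
Lemma misfitB_sqr_le r y y' (v : 'M[R]_(J.+1, n)) : enorm y <= r -> enorm y' <= r ->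
  (misfit h Gamma y v - misfit h Gamma y' v) ^+ 2 <=
  J%:R * (2 * K ^+ 2 * (r ^+ 2 + 1)) * enorm (y - y') ^+ 2 * V v.
Proof.
move=> yr y'r; rewrite -sumrB; apply: le_trans (sum_sqr_le _) _.
rewrite -[_ * V v]mulrA -[J%:R * _ * _]mulrA ler_wpM2l// 2!mulr_sumr.
apply: ler_sum => j _.
set x := h _; rewrite -mulrBr exprMn.
have K0 : 0 <= K by exact: sqr_ge0.
have yy : wnorm Gamma (row j y - row j y') ^+ 2 <= K * enorm (y - y') ^+ 2.
  apply: le_trans (wnorm_sqr_le _ _) _; rewrite ler_wpM2l// -linearB.
  exact: enorm_row_le.
have yx : wnorm Gamma (row j y - x + (row j y' - x)) ^+ 2 <=
    K * (8 * (r ^+ 2 + 1) * (1 + enorm x ^+ 2)).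
  apply: le_trans (wnorm_sqr_le _ _) _; rewrite ler_wpM2l//.
  apply: le_trans (enormD_sqr_le _ _) _.
  have := enorm_residual_le x j yr; have := enorm_residual_le x j y'r; lra.
have := wnorm_sqrB_sqr_le Gamma (row j y - x) (row j y' - x).
rewrite (_ : row j y - x - _ = row j y - row j y'); last first.
  by rewrite opprB addrA subrK.
have := ler_pM (sqr_ge0 _) (sqr_ge0 _) yy yx; lra.
Qed.

End misfit_bounds.

Theorem theorem2p15 (R : realType) (n m J : nat)
    (n_gt0 : (0 < n)%N) (m_gt0 : (0 < m)%N) (J_gt0 : (0 < J)%N)
    (Psi : continuousType 'rV[R]_n 'rV[R]_n)
    (h : continuousType 'rV[R]_n 'rV[R]_m)
    (m0 : 'rV[R]_n) (C0 Sigma : 'M[R]_n) (Gamma : 'M[R]_m)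
    (C0_spd : spd C0) (Sigma_spd : spd Sigma) (Gamma_spd : spd Gamma) :
  ('E_(prior Psi m0 C0 Sigma)
     [(fun v : 'M[R]_(J.+1, n) =>
         \sum_(j < J) (1 + enorm (h (next_state v j)) ^+ 2))%R] < +oo)%E ->
  forall r : R, 0 < r ->
  exists c : R, forall y y' : 'M[R]_(J, m), enorm y <= r -> enorm y' <= r ->
    (hellinger (lebesgue_mx J.+1 n)
       (posterior Psi h m0 C0 Sigma Gamma y)
       (posterior Psi h m0 C0 Sigma Gamma y')
     <= (c * enorm (y - y'))%:E)%E.
Proof.
pose lam : {sigma_finite_measure set 'M[R]_(J.+1, n) -> \bar R} :=
  lebesgue_mx J.+1 n.
pose V (v : 'M[R]_(J.+1, n)) :=
  \sum_(j < J) (1 + enorm (h (next_state v j)) ^+ 2).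
pose p := prior_potential Psi m0 C0 Sigma : 'M[R]_(J.+1, n) -> R.
rewrite unlock => EV r r_gt0.
have lam_gt0 : (0 < lam setT)%E by exact: lebesgue_mx_setT_gt0.
have V_ge0 v : 0 <= V v by apply: sumr_ge0 => j _; rewrite addr_ge0// sqr_ge0.
have mV : measurable_fun setT V.
  apply: measurable_sum => j; apply: measurable_funD => //.
  apply: measurable_enorm_sqr; apply: measurableT_comp.
    exact: measurable_continuousType.
  exact: measurable_row.
have mp : measurable_fun setT p by exact: measurable_prior_potential.
(* Any potential above the prior one has a finite positive mass; this is used for [p], for p + A V
   and for the posterior potentials. *)
have massE (g : 'M[R]_(J.+1, n) -> R) : measurable_fun setT g ->
    (forall v, p v <= g v) ->
    exists2 Z : R, 0 < Z & (\int[lam]_v (expR (- g v))%:E = Z%:E)%E.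
  move=> mg pg.
  have gt0 := integral_expRN_gt0 mg lam_gt0.
  have lty : (\int[lam]_v (expR (- g v))%:E < +oo)%E.
    apply: le_lt_trans (prior_mass_lty J Psi m0 C0_spd Sigma_spd).
    apply: ge0_le_integral => //.
    - by apply/measurable_EFinP/measurableT_comp => //; exact: measurable_funN.
    - by apply/measurable_EFinP/measurableT_comp => //; exact: measurable_funN.
    - by move=> v _; rewrite lee_fin ler_expR lerN2.
  have fin : (\int[lam]_v (expR (- g v))%:E)%E \is a fin_num.
    by rewrite ge0_fin_numE// ltW.
  exists (fine (\int[lam]_v (expR (- g v))%:E)%E); last by rewrite fineK.
  by rewrite -lte_fin fineK.
have [Z0 Z0_gt0 intZ0] := massE p mp (fun=> lexx _).
(* [W] is [V] times the prior density, so its integral is finite by [EV]. *)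
pose W v : \bar R := ((V v)%:E * (expR (- p v) / Z0)%:E)%E.
have W_ge0 v : (0 <= W v)%E.
  by rewrite /W -EFinM lee_fin mulr_ge0// divr_ge0 ?expR_ge0// ltW.
have mW : measurable_fun setT W.
  apply: emeasurable_funM; apply/measurable_EFinP => //.
  apply: measurable_funM => //; apply: measurableT_comp => //.
  exact: measurable_funN.
have intW : (\int[lam]_v W v < +oo)%E.
  apply: (@integral_gibbs_probability_lty _ _ _ lam p Z0 Z0_gt0 intZ0
    (EFin \o V)) => //.
  exact/measurable_EFinP.
have finW : (\int[lam]_v W v)%E \is a fin_num.
  by rewrite ge0_fin_numE// integral_ge0.
pose M := fine (\int[lam]_v W v)%E.
have M_ge0 : 0 <= M by rewrite fine_ge0// integral_ge0.
pose K := enorm (invmx (sqrtmx Gamma)) ^+ 2.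
pose A := K * (r ^+ 2 + 1).
pose C := J%:R * (2 * K ^+ 2 * (r ^+ 2 + 1)).
have r2_ge0 : 0 <= r ^+ 2 + 1 by rewrite addr_ge0 ?sqr_ge0.
have A_ge0 : 0 <= A by rewrite mulr_ge0// sqr_ge0.
have C_ge0 : 0 <= C by rewrite !mulr_ge0// enorm_ge0.
have [z z_gt0 intz] : exists2 Z : R, 0 < Z &
    (\int[lam]_v (expR (- (p v + A * V v)))%:E = Z%:E)%E.
  apply: massE => [|v]; last by rewrite lerDl mulr_ge0.
  by apply: measurable_funD => //; exact: measurable_funM.
(* 1/z bounds the inverse of sqrt Z * sqrt Z'; C / 4 comes from the halved misfits; Z0 undoes the
   normalization in [W]. *)
pose c0 := 2^-1 / z * (C / 4 * Z0 * M).
have c0_ge0 : 0 <= c0.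
  apply: mulr_ge0; first by rewrite divr_ge0// ltW.
  by rewrite mulr_ge0// mulr_ge0 ?divr_ge0// ltW.
exists (Num.sqrt c0) => y y' yr y'r.
pose q (y1 : 'M[R]_(J, m)) : 'M[R]_(J.+1, n) -> R :=
  posterior_potential Psi h m0 C0 Sigma Gamma y1.
have mq y1 : measurable_fun setT (q y1).
  exact: measurable_posterior_potential.
(* The misfit is at most A V on the ball of radius [r], so [z] is a lower bound common to all data
   in it. *)
have mass y1 : enorm y1 <= r -> exists2 Z : R, z <= Z &
    (\int[lam]_v (expR (- q y1 v))%:E = Z%:E)%E.
  move=> y1r; have [|Z Z_gt0 intZ] := massE _ (mq y1).
    by move=> v; rewrite lerDl misfit_ge0.
  exists Z => //; rewrite -lee_fin -intz -intZ; apply: ge0_le_integral => //.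
  - apply/measurable_EFinP/measurableT_comp => //; apply: measurable_funN.
    by apply: measurable_funD => //; exact: measurable_funM.
  - by apply/measurable_EFinP/measurableT_comp => //; exact: measurable_funN.
  - by move=> v _; rewrite lee_fin ler_expR lerN2 lerD2l; exact: misfit_le.
have [Z zZ intZ] := mass y yr; have [Z' zZ' intZ'] := mass y' y'r.
have Z_gt0 := lt_le_trans z_gt0 zZ; have Z'_gt0 := lt_le_trans z_gt0 zZ'.
apply: le_trans (hellinger_gibbs_le Z_gt0 Z'_gt0 intZ intZ') _.
set D := enorm _; set I := (\int[lam]_v _)%E.
have D_ge0 : 0 <= D by exact: enorm_ge0.
have I_ge0 : (0 <= I)%E by apply: integral_ge0 => v _; rewrite lee_fin sqr_ge0.
have I_le : (I <= (C / 4 * Z0 * M * D ^+ 2)%:E)%E.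
  have -> : ((C / 4 * Z0 * M * D ^+ 2)%:E =
      (C / 4 * Z0 * D ^+ 2)%:E * \int[lam]_v W v)%E.
    by rewrite -[X in (_ * X)%E]fineK// -EFinM; congr EFin; rewrite -/M; ring.
  have c_ge0 : 0 <= C / 4 * Z0 * D ^+ 2.
    by rewrite mulr_ge0 ?sqr_ge0// mulr_ge0 ?divr_ge0// ltW.
  rewrite -ge0_integralZl_EFin//; apply: ge0_le_integral => //.
  - by move=> v _; rewrite lee_fin sqr_ge0.
  - apply/measurable_EFinP/measurable_funX/measurable_funB.
      apply: measurableT_comp => //; apply: measurable_funN; exact: measurable_funM.
    apply: measurableT_comp => //; apply: measurable_funN; exact: measurable_funM.
  - exact: emeasurable_funM.
  move=> v _; rewrite /W -!EFinM lee_fin.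
  pose a := misfit h Gamma y v; pose a' := misfit h Gamma y' v.
  have splitE y1 : expR (- (q y1 v / 2)) =
      expR (- (p v / 2)) * expR (- (misfit h Gamma y1 v / 2)).
    by rewrite -expRD /q /posterior_potential -/p; congr expR; lra.
  have pE : expR (- p v) = expR (- (p v / 2)) ^+ 2.
    by rewrite expr2 -expRD; congr expR; lra.
  have a_ge0 : 0 <= a / 2 by rewrite divr_ge0// misfit_ge0.
  have a'_ge0 : 0 <= a' / 2 by rewrite divr_ge0// misfit_ge0.
  (* The common factor exp(- p / 2) is taken out, and the Lipschitz bound is applied to the halved
     misfits only. *)
  rewrite -/(q y v) -/(q y' v) !splitE -mulrBr exprMn pE.
  have -> : C / 4 * Z0 * D ^+ 2 * (V v * (expR (- (p v / 2)) ^+ 2 / Z0)) =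
      expR (- (p v / 2)) ^+ 2 * (C * D ^+ 2 * V v / 4).
    by field; rewrite gt_eqF.
  rewrite ler_wpM2l ?sqr_ge0//; apply: le_trans (expRN_lipschitz a_ge0 a'_ge0) _.
  have := misfitB_sqr_le h Gamma v yr y'r; rewrite -/a -/a' -/K -/C -/D -/(V v).
  lra.
have -> : (Num.sqrt c0 * D)%:E = sqrte (c0 * D ^+ 2)%:E.
  by rewrite /= (sqrtrM _ c0_ge0) sqrtr_sqr ger0_norm.
rewrite lee_sqrt; last by rewrite lee_fin mulr_ge0// sqr_ge0.
have -> : (c0 * D ^+ 2)%:E = ((2^-1 / z)%:E * (C / 4 * Z0 * M * D ^+ 2)%:E)%E.
  by rewrite -EFinM; congr EFin; rewrite /c0; ring.
apply: lee_pmul => //.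
rewrite lee_fin ler_wpM2l// lef_pV2 ?posrE ?mulr_gt0 ?sqrtr_gt0//.
rewrite -[leLHS](sqr_sqrtr (ltW z_gt0)) expr2.
by rewrite ler_pM ?sqrtr_ge0// ler_wsqrtr.
Qed.
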